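(* Let $n\ge 3$ be fixed. For every family of finite $\alpha$-expander graphs $\Gamma$ with a fixed $\alpha>0$ and degrees bounded by a fixed integer $d$, the intrinsic distortion with respect to embeddings into $\mathbb{R}^n$ satisfies $D_n(\Gamma)=\Omega\bigl(N^{1/(n-1)}\bigr)$, where $N$ is the number of vertices of $\Gamma$. That is, there is a constant $C(\alpha,d,n)>0$, depending only on $\alpha,d,n$, such that $$D_n(\Gamma)>C(\alpha,d,n)\,N^{\frac{1}{n-1}}$$ for every finite $\alpha$-expander graph $\Gamma$ of degree $\le d$ with $N$ vertices.
   Context: A finite graph $\Gamma$ with vertex set $V$ is an $\alpha$-expander if whenever $S\subset V$ is a set of vertices with $|S|\le|V|/2$, the number of edges connecting vertices in $S$ to vertices in $V\smallsetminus S$ is at least $\alpha|S|$. ''Degree $\le d$'' means that each vertex has degree at most $d$. For a subset $K\subset\mathbb{R}^n$ and $x,y\in K$, let $d_K(x,y)$ be the intrinsic metric: the infimum of the lengths of paths in $K$ connecting $x$ and $y$. The distortion of $K$ is $$\delta(K)=\sup_{x,y\in K,\;x\ne y}\frac{d_K(x,y)}{d_{\mathbb{R}^n}(x,y)}.$$ The intrinsic distortion of a complex $K$ with respect to embeddings in $\mathbb{R}^n$ is $D_n(K)=\inf_i\delta(i(K))$, where the infimum is over all embeddings $i:K\hookrightarrow\mathbb{R}^n$. For a graph $\Gamma$ the distortion is measured on the entire graph viewed as a $1$-complex (including its edges), not just on the vertex set. *)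

(* Defs.v *)
From mathcomp Require Import all_boot all_order all_algebra.
From mathcomp Require Import all_classical all_reals all_analysis.
Import Order.TTheory GRing.Theory Num.Theory.
Import numFieldNormedType.Exports.

Set Implicit Arguments.
Unset Strict Implicit.
Unset Printing Implicit Defensive.

Local Open Scope classical_set_scope.
Local Open Scope ring_scope.

(* A finite simple graph is a symmetric irreflexive relation [e] on a finType. *)

Definition degree (V : finType) (e : rel V) (v : V) : nat :=
  #|[set u | e v u]%SET|.

(* An edge between S and its complement has exactly one orientation leaving S,
   so counting the ordered pairs (x, y) with x in S and y outside S counts each
   such edge once. *)
Definition edge_boundary (V : finType) (e : rel V) (S : {set V}) : {set V * V} :=
  [set p : V * V | [&& p.1 \in S, p.2 \notin S & e p.1 p.2]]%SET.

Definition is_expander (R : realType) (alpha : R) (V : finType) (e : rel V) : Prop :=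
  forall S : {set V}, #|S|%:R <= #|V|%:R / 2 :> R ->
    alpha * #|S|%:R <= #|edge_boundary e S|%:R.

(* A complex is given by the set of its (nonempty) simplices; a graph is a
   1-dimensional simplicial complex. *)
Definition graph_complex (V : finType) (e : rel V) : {set {set V}} :=
  ([set [set v] | v : V] :|: [set [set p.1; p.2] | p : V * V & e p.1 p.2])%SET.

(* Geometric realization in barycentric coordinates, as a subset of R^V. *)
Definition realization (R : realType) (V : finType) (K : {set {set V}}) :
    set {ptws V -> R} :=
  [set x | [/\ forall v, 0 <= x v,
               \sum_v x v = 1 &
               [set v | x v != 0]%SET \in K]].

(* Topological embedding of the subspace X of T: homeomorphism onto its image. *)
Definition is_embedding (T U : topologicalType) (X : set T) (i : T -> U) : Prop :=
  {within X, continuous i} /\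
  exists2 g : U -> T,
    {within i @` X, continuous g} & forall x, X x -> g (i x) = x.

(* The norm of the library on 'rV[R]_n is the sup norm; it induces the same
   topology as this Euclidean distance. *)
Definition edist (R : realType) (n : nat) (x y : 'rV[R]_n) : R :=
  Num.sqrt (\sum_(j < n) (x ord0 j - y ord0 j) ^+ 2).

(* Euclidean analogue of [variation]: the length of the polygonal line inscribed
   in the curve c along the partition a :: s of [a, b]. *)
Definition polygonal_length (R : realType) (n : nat) (a b : R)
    (c : R -> 'rV[R]_n) (s : seq R) : R :=
  let F := c \o nth b (a :: s) in
  \sum_(0 <= k < size s) edist (F k) (F k.+1).

Definition curve_length (R : realType) (n : nat) (a b : R)
    (c : R -> 'rV[R]_n) : \bar R :=
  ereal_sup [set (polygonal_length a b c s)%:E | s in itv_partition a b].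

Definition path_in (R : realType) (n : nat) (K : set 'rV[R]_n) (x y : 'rV[R]_n)
    (c : R -> 'rV[R]_n) : Prop :=
  [/\ {within `[0, 1], continuous c},
      forall t, 0 <= t <= 1 -> K (c t),
      c 0 = x & c 1 = y].

(* Equal to +oo when x and y are not joined by a path of finite length in K. *)
Definition intrinsic_dist (R : realType) (n : nat) (K : set 'rV[R]_n)
    (x y : 'rV[R]_n) : \bar R :=
  ereal_inf [set curve_length 0 1 c | c in path_in K x y].

Definition distortion (R : realType) (n : nat) (K : set 'rV[R]_n) : \bar R :=
  ereal_sup [set r | exists x y, [/\ K x, K y, x != y &
    r = (intrinsic_dist K x y / (edist x y)%:E)%E]].

Definition intrinsic_distortion (R : realType) (n : nat) (V : finType)
    (K : {set {set V}}) : \bar R :=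
  ereal_inf [set distortion (i @` realization K) |
    i in [set i : {ptws V -> R} -> 'rV[R]_n | is_embedding (realization K) i]].
Arguments intrinsic_distortion R n {V} K.

(* Main.v *)
Require Import Defs.
From mathcomp Require Import all_boot all_order all_algebra.
From mathcomp Require Import all_classical all_reals all_analysis.
From mathcomp Require Import ring lra zify.
Import Order.TTheory GRing.Theory Num.Theory.
Import numFieldNormedType.Exports.

(** The distortion is invariant under scaling, so the proof first finds the scale
    at which the embedded graph is spread out.  Let m be a small constant fraction
    of the number N of vertices and let r be the smallest radius of a cube centred
    at an embedded vertex that contains at least m embedded vertices
    ([smallest_ball]).  The concentric cube of radius 2r is covered by 5^n cells of
    diameter less than r; by minimality each cell has fewer than m vertices, so
    the large cube has at most N/2 of them.  Hence for every radius rho in [r, 2r]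
    the cube of radius rho cuts off a set of vertices to which the expansion
    hypothesis applies, and at least alpha m edges cross its boundary.

    Some of these edges may cross very close to one of their endpoints.  With M
    equally spaced radii in [r, 2r], every vertex is within r/(2M) of at most one
    of the corresponding cube boundaries, so on average over the M radii only a
    fraction O(1/M) of the at most dN edges is affected ([pigeonhole_level]).  For
    M large, depending on alpha, d and n, some radius keeps a constant fraction of
    N crossing edges whose endpoints are all at distance at least r/(2M) from the
    cube boundary ([clear_crossing_edges]).

    On each of these edges choose a point of the cube boundary.  A path in the graph
    from one chosen point to another must leave the first edge through an
    endpoint, so it has length at least r/(2M) ([intrinsic_dist_leave_edge]); if the
    distortion is at most B, the chosen points are therefore at mutual distance of
    order at least r/B.  The boundary of a cube of side of order r in dimension n
    contains only O(B^(n-1)) such points ([cube_boundary_packing],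
    [separated_crossings]), so N = O(B^(n-1)) ([expander_card_le]).

    Cubes rather than round balls appear because the norm of the row vectors is
    the sup norm: covering and packing then reduce to counting grid cells, and the
    comparison with the Euclidean distance costs only a factor n. *)

Set Implicit Arguments.
Unset Strict Implicit.
Unset Printing Implicit Defensive.

Local Open Scope classical_set_scope.
Local Open Scope ring_scope.

(* The Euclidean distance, as opposed to the extended distance of pseudometric
   spaces that bears the same name. *)
Local Notation edist := Defs.edist.

(** * Covering and packing in the sup norm *)

Lemma coord_le_norm (R : realType) (n : nat) (x : 'rV[R]_n) (j : 'I_n) :
  `|x ord0 j| <= `|x|.
Proof.
rewrite [leRHS]/Num.norm /= mx_normrE.
exact: (le_bigmax _ (fun ij : 'I_1 * 'I_n => `|x ij.1 ij.2|) (ord0, j)).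
Qed.

Lemma norm_attained (R : realType) (n : nat) (x : 'rV[R]_n) :
  0 < `|x| -> exists j, `|x| = `|x ord0 j|.
Proof.
move=> x0; have /mx_norm_neq0[[i j] /= E] : mx_norm x != 0 by exact: lt0r_neq0.
by exists j; rewrite [LHS]E ord1.
Qed.

Lemma norm_lt_coord (R : realType) (n : nat) (x : 'rV[R]_n) (s : R) :
  0 < s -> (forall j, `|x ord0 j| < s) -> `|x| < s.
Proof.
move=> s0 xs; have [x0|x0] := ltP 0 `|x|; last exact: le_lt_trans s0.
by have [j ->] := norm_attained x0.
Qed.

Lemma norm_le_edist (R : realType) (n : nat) (x y : 'rV[R]_n) :
  `|x - y| <= edist x y.
Proof.
have [x0|x0] := ltP 0 `|x - y|; last by apply: le_trans x0 (sqrtr_ge0 _).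
have [j ->] := norm_attained x0; rewrite !mxE -sqrtr_sqr ler_wsqrtr//.
by rewrite (bigD1 j)//= lerDl sumr_ge0// => i _; rewrite sqr_ge0.
Qed.

Lemma edist_le_norm (R : realType) (n : nat) (x y : 'rV[R]_n) :
  edist x y <= n%:R * `|x - y|.
Proof.
rewrite -[leRHS]ger0_norm ?mulr_ge0// -sqrtr_sqr ler_wsqrtr//.
apply: (@le_trans _ _ (n%:R * `|x - y| ^+ 2)).
  rewrite mulr_natl -[X in _ *+ X]card_ord -sumr_const ler_sum// => j _.
  have := coord_le_norm (x - y) j; rewrite !mxE => h.
  by rewrite -real_normK ?num_real// ler_sqr ?nnegrE.
rewrite exprMn ler_wpM2r ?sqr_ge0// -natrX ler_nat.
by case: (n) => // k; rewrite leq_pmulr.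
Qed.

Lemma cell_dist_lt (R : realType) (s u w : R) : 0 < s -> 0 <= u -> 0 <= w ->
  Num.truncn (u / s) = Num.truncn (w / s) -> `|u - w| < s.
Proof.
move=> s0 u0 w0 E.
have /truncn_itv/andP[u1 u2] : 0 <= u / s by rewrite divr_ge0// ltW.
have /truncn_itv/andP[w1 w2] : 0 <= w / s by rewrite divr_ge0// ltW.
have -> : u - w = (u / s - w / s) * s by rewrite mulrBl !divfK ?gt_eqF.
rewrite normrM (gtr0_norm s0) -[ltRHS]mul1r ltr_pM2r// ltr_norml.
rewrite E in u1 u2; rewrite -natr1 in u2 w2.
by move: u1 u2 w1 w2; set a := u / s; set b := w / s; set t := _%:R; lra.
Qed.

(** The interval [-rho, rho] is cut into consecutive half-open pieces of length s,
    numbered from 0; the last one may stick out. *)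
Definition cell (R : realType) (rho s u : R) : 'I_(Num.truncn (2 * rho / s)).+1 :=
  inord (Num.truncn ((u + rho) / s)).

Lemma cellP (R : realType) (rho s u w : R) : 0 < s ->
  `|u| <= rho -> `|w| <= rho -> cell rho s u = cell rho s w -> `|u - w| < s.
Proof.
move=> s0 ur wr /(congr1 val); rewrite /cell /= !inordK; first last.
- rewrite ltnS le_truncn// ler_pM2r ?invr_gt0//.
  by have := ler_normlW ur; have := ler_normlW wr; lra.
- rewrite ltnS le_truncn// ler_pM2r ?invr_gt0//.
  by have := ler_normlW ur; have := ler_normlW wr; lra.
move=> /cell_dist_lt h; have -> : u - w = (u + rho) - (w + rho) by lra.
by apply: h => //; have := lerNnormlW ur; have := lerNnormlW wr; lra.
Qed.

(** Two points in the same cell of a grid of mesh s are at distance less than s, so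
    each cell contains at most m of the points. *)
Lemma cube_cover (R : realType) (n : nat) (T : finType) (A : {set T})
    (z : T -> 'rV[R]_n) (p : 'rV[R]_n) (rho s : R) (m : nat) : 0 < s ->
  (forall a, a \in A -> `|z a - p| <= rho) ->
  (forall a, a \in A -> (#|[set b in A | (`|z a - z b| < s)%R]%SET| <= m)%N) ->
  (#|A| <= m * (Num.truncn (2 * rho / s)).+1 ^ n)%N.
Proof.
move=> s0 zr zm.
pose f a : {ffun 'I_n -> _} := [ffun j => cell rho s ((z a - p) ord0 j)].
rewrite -[X in (_ <= m * (X ^ _))%N]card_ord -[X in (_ <= m * (_ ^ X))%N]card_ord.
rewrite -card_ffun mulnC -sum1_card (partition_big f xpredT)//= -sum_nat_const.
apply: leq_sum => c _; rewrite sum1dep_card.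
set F := [set x | _]%SET.
have [/set0Pn[a]|/negPn/eqP->] := boolP (F != finset.set0); last by rewrite cards0.
rewrite inE => /andP[aA /eqP fa]; apply: leq_trans (zm a aA).
apply/subset_leq_card/fintype.subsetP => b.
rewrite !inE => /andP[bA /eqP fb]; rewrite bA/=.
apply: norm_lt_coord => // j.
have -> : (z a - z b) ord0 j = (z a - p) ord0 j - (z b - p) ord0 j.
  by rewrite !mxE; lra.
have /ffunP/(_ j) := etrans fa (esym fb); rewrite !ffunE.
by apply: cellP => //; apply: le_trans (coord_le_norm _ _) (zr _ _).
Qed.

(** A point of the boundary of the cube lies on one of the 2(n+1) faces, and the
    remaining n coordinates place it in a cell of mesh s; s-separated points
    cannot share both the face and the cell. *)
Lemma cube_boundary_packing (R : realType) (n : nat) (T : finType) (A : {set T})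
    (z : T -> 'rV[R]_n.+1) (p : 'rV[R]_n.+1) (rho s : R) : 0 < s -> 0 < rho ->
  (forall a, a \in A -> `|z a - p| = rho) ->
  (forall a b, a \in A -> b \in A -> a != b -> s <= `|z a - z b|) ->
  (#|A| <= 2 * n.+1 * (Num.truncn (2 * rho / s)).+1 ^ n)%N.
Proof.
move=> s0 r0 zr zs.
have ex a : exists j, (a \in A) ==> (`|(z a - p) ord0 j| == rho).
  have [aA|] := boolP (a \in A); last by exists ord0.
  have /norm_attained[j E] : 0 < `|z a - p| by rewrite zr.
  by exists j; rewrite -E zr ?eqxx.
pose face a := xchoose (ex a).
have faceP a : a \in A -> `|(z a - p) ord0 (face a)| = rho.
  by move=> aA; have /implyP/(_ aA)/eqP := xchooseP (ex a).
pose f a : bool * 'I_n.+1 * {ffun 'I_n -> _} :=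
  (0 < (z a - p) ord0 (face a), face a,
    [ffun j => cell rho s ((z a - p) ord0 (lift (face a) j))]).
suff /leq_card_in : {in A &, injective f}.
  by rewrite !card_prod card_bool card_ffun !card_ord.
move=> a b aA bA; rewrite /f; case=> sg fE /ffunP cE.
apply/eqP/contraT => /(zs _ _ aA bA); apply/contraTT => _; rewrite -ltNge.
apply: norm_lt_coord => // j.
have -> : (z a - z b) ord0 j = (z a - p) ord0 j - (z b - p) ord0 j.
  by rewrite !mxE; lra.
case: (unliftP (face a) j) => [k|] ->.
  have := cE k; rewrite !ffunE -fE; apply: cellP => //.
    by rewrite -(zr a aA) coord_le_norm.
  by rewrite -(zr b bA) coord_le_norm.
have := faceP a aA; have := faceP b bA; move: sg; rewrite -fE.
set u := (z a - p) _ _; set w := (z b - p) _ _.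
have [u0|u0] := ltP 0 u; have [w0|w0] := ltP 0 w => // _.
  by rewrite (gtr0_norm u0) (gtr0_norm w0) => -> ->; rewrite subrr normr0.
by rewrite (ler0_norm u0) (ler0_norm w0) => <-/oppr_inj->; rewrite subrr normr0.
Qed.

(** * Lengths of curves and distortion *)

Lemma continuous_within_comp (T U W : topologicalType) (A : set T) (B : set U)
    (f : T -> U) (g : U -> W) :
  {within A, continuous f} -> {within B, continuous g} ->
  (forall x, A x -> B (f x)) -> {within A, continuous (g \o f)}.
Proof.
move=> /subspace_continuousP cf /subspace_continuousP cg AB.
apply/subspace_continuousP => x Ax.
apply: cvg_trans (cg _ (AB _ Ax)) => S /= BS.
have := cf x Ax _ BS; rewrite /= !nbhs_simpl/= /within/= !near_simpl => h.
by apply: filterS h => t h At; apply: h => //; exact: AB.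
Qed.

(** The partition of [0, 1] at t already gives an inscribed polygonal line that is
    at least this long. *)
Lemma curve_length_ge (R : realType) (n : nat) (c : R -> 'rV[R]_n) (t : R) :
  0 < t <= 1 -> ((edist (c 0) (c t))%:E <= curve_length 0 1 c)%E.
Proof.
move=> /andP[t0]; rewrite le_eqVlt => /predU1P[->|t1].
  apply: ereal_sup_ubound; exists [:: 1].
    by split; rewrite /= ?ltr01 ?eqxx.
  by rewrite /polygonal_length /= big_nat1.
apply: (@le_trans _ _ (polygonal_length 0 1 c [:: t; 1])%:E); last first.
  apply: ereal_sup_ubound; exists [:: t; 1] => //.
  by split; rewrite /= ?t0 ?t1 ?eqxx.
rewrite lee_fin /polygonal_length /= big_nat_recl//= big_nat1/= lerDl.
exact: sqrtr_ge0.
Qed.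

Lemma intrinsic_dist_ge_edist (R : realType) (n : nat) (K : set 'rV[R]_n)
    (x y : 'rV[R]_n) : ((edist x y)%:E <= intrinsic_dist K x y)%E.
Proof.
apply: le_ereal_inf_tmp => _ [c [_ _ <- <-]] <-.
by apply: curve_length_ge; rewrite ltr01 lexx.
Qed.

Lemma distortion_edist_ge (R : realType) (n : nat) (K : set 'rV[R]_n)
    (B delta : R) (x y : 'rV[R]_n) :
  (distortion K <= B%:E)%E -> K x -> K y -> x != y ->
  (delta%:E <= intrinsic_dist K x y)%E -> delta <= B * edist x y.
Proof.
move=> KB Kx Ky xy dxy.
have e0 : 0 < edist x y.
  by apply: lt_le_trans (norm_le_edist x y); rewrite normr_gt0 subr_eq0.
rewrite -lee_fin; apply: le_trans dxy _.
rewrite EFinM -lee_pdivrMr//; apply: le_trans KB; apply: ereal_sup_ubound.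
by exists x, y; split=> //; rewrite inver gt_eqF.
Qed.

(** * The realization of a graph in barycentric coordinates *)

Definition vertex_point (R : realType) (V : finType) (v : V) : {ptws V -> R} :=
  fun w => (w == v)%:R.

Definition edge_point (R : realType) (V : finType) (x y : V) (t : R) :
  {ptws V -> R} := fun w => (1 - t) * (w == x)%:R + t * (w == y)%:R.

Lemma edge_point0 (R : realType) (V : finType) (x y : V) :
  edge_point x y 0 = vertex_point R x.
Proof. by apply: funext => w; rewrite /edge_point /vertex_point; lra. Qed.

Lemma edge_point1 (R : realType) (V : finType) (x y : V) :
  edge_point x y 1 = vertex_point R y.
Proof. by apply: funext => w; rewrite /edge_point /vertex_point; lra. Qed.

Lemma vertex_point_inj (R : realType) (V : finType) :
  injective (@vertex_point R V).
Proof.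
move=> x y /(congr1 (fun f : V -> R => f x)); rewrite /vertex_point eqxx.
by case: eqVneq => // _ /eqP; rewrite oner_eq0.
Qed.

Lemma edge_point_continuous (R : realType) (V : finType) (x y : V) :
  continuous (edge_point x y : R -> {ptws V -> R}).
Proof.
move=> t; apply/cvg_sup => w.
move: t; apply: continuous_comp_initial => t.
rewrite /comp /proj /edge_point.
apply: cvgD; apply: cvgMr_tmp; last exact: cvg_id.
by apply: cvgB; [exact: cvg_cst|exact: cvg_id].
Qed.

Lemma vertex_point_realization (R : realType) (V : finType) (e : rel V) (v : V) :
  realization (graph_complex e) (vertex_point R v).
Proof.
split => [w||].
- by rewrite /vertex_point ler0n.
- by rewrite /vertex_point (bigD1 v)//= eqxx big1 ?addr0// => w /negPf->.
- rewrite inE; apply/orP; left; apply/imsetP; exists v => //.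
  apply/setP => w; rewrite !inE /vertex_point.
  by rewrite pnatr_eq0 eqb0 negbK.
Qed.

Lemma edge_point_realization (R : realType) (V : finType) (e : rel V) (x y : V)
    (t : R) : e x y -> x != y -> 0 <= t <= 1 ->
  realization (graph_complex e) (edge_point x y t).
Proof.
move=> exy xy /andP[t0 t1].
have [->|tn0] := eqVneq t 0.
  by rewrite edge_point0; exact: vertex_point_realization.
have [->|tn1] := eqVneq t 1.
  by rewrite edge_point1; exact: vertex_point_realization.
split => [w||].
- by rewrite /edge_point addr_ge0// mulr_ge0// ?ler0n// subr_ge0.
- have sum1 v : \sum_w (w == v)%:R = 1 :> R.
    by rewrite (bigD1 v)//= eqxx big1 ?addr0// => w /negPf->.
  by rewrite /edge_point big_split/= -!mulr_sumr !sum1; lra.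
- rewrite inE; apply/orP; right; apply/imsetP; exists (x, y); first by rewrite inE.
  apply/setP => w; rewrite !inE /edge_point/=.
  have [->|wx] := eqVneq w x.
    by rewrite (negPf xy) mulr0 mulr1 addr0 subr_eq0 eq_sym tn1.
  by have [_|_] := eqVneq w y; rewrite mulr0 add0r ?mulr1 ?mulr0 ?eqxx.
Qed.

(** On the realization, the sum of the barycentric coordinates at x and y is 1
    exactly on the closed edge xy, and their product vanishes off the open edge xy.
    Hence this continuous function is positive inside the edge, zero exactly at
    its two endpoints and negative elsewhere: a path can be seen to leave the edge
    by looking at a sign. *)
Definition edge_gauge (R : realType) (V : finType) (x y : V) (w : {ptws V -> R}) :
  R :=
  w x + w y - 1 + w x * w y.

Lemma edge_gauge_continuous (R : realType) (V : finType) (x y : V) :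
  continuous (@edge_gauge R V x y).
Proof.
have cp v : continuous (fun w : {ptws V -> R} => w v).
  exact: (@proj_continuous V (fun _ => R) v).
move=> w; have cx := cp x w; have cy := cp y w.
rewrite /edge_gauge.
have F := nbhs_filter w.
have /(_ F) h1 := cvgM cx cy; have /(_ F) h2 := cvgD cx cy.
have /(_ F F) h3 := cvgB h2 (cvg_cst (1 : R)).
by have /(_ F) := cvgD h3 h1.
Qed.

(** If both coordinates are nonzero then the support of w, which is a vertex or an
    edge, has to be the edge xy. *)
Lemma realization_edge_sum (R : realType) (V : finType) (e : rel V) (x y : V)
    (w : {ptws V -> R}) : x != y -> realization (graph_complex e) w ->
  w x * w y != 0 -> w x + w y = 1.
Proof.
move=> xy [w0 w1 wK]; rewrite mulf_eq0 negb_or => /andP[wx wy].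
have xS : x \in [set v | w v != 0]%SET by rewrite inE.
have yS : y \in [set v | w v != 0]%SET by rewrite inE.
suff E : [set v | w v != 0]%SET = [set x; y]%SET.
  rewrite -w1 (bigD1 x)//= (bigD1 y)/= 1?eq_sym//.
  rewrite big1 ?addr0// => v /andP[vx vy].
  have : v \notin [set v | w v != 0]%SET by rewrite E !inE negb_or vx.
  by rewrite inE negbK => /eqP.
move: wK; rewrite /graph_complex finset.in_setU => wK; move: wK xS yS.
move=> /orP[/imsetP[v _ ->]|/imsetP[[a b] _ ->]].
  by rewrite !inE => /eqP xv /eqP yv; rewrite xv yv eqxx in xy.
rewrite !inE/= => /orP[]/eqP xE /orP[]/eqP yE.
- by rewrite xE yE eqxx in xy.
- by rewrite xE yE.
- by rewrite xE yE finset.setUC.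
- by rewrite xE yE eqxx in xy.
Qed.

(** If the product of the coordinates is nonzero then the gauge equals the product;
    otherwise it vanishes only if all the mass of w sits on x or on y. *)
Lemma edge_gauge0 (R : realType) (V : finType) (e : rel V) (x y : V)
    (w : {ptws V -> R}) : x != y -> realization (graph_complex e) w ->
  edge_gauge x y w = 0 -> w = vertex_point R x \/ w = vertex_point R y.
Proof.
move=> xy Kw; have [w0 w1 _] := Kw; rewrite /edge_gauge.
have [p0|pn0] := eqVneq (w x * w y) 0; last first.
  rewrite (realization_edge_sum xy Kw pn0) subrr add0r => p0.
  by rewrite p0 eqxx in pn0.
rewrite p0 => /eqP; rewrite addr0 subr_eq0 => /eqP s1.
have wz v : v != x -> v != y -> w v = 0.
  move=> vx vy; apply/eqP; rewrite eq_le w0 andbT.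
  have : w x + w y + w v <= 1.
    rewrite -w1 (bigD1 x)//= (bigD1 y)/= 1?eq_sym// (bigD1 v)/= ?vx ?vy//.
    by rewrite !addrA lerDl sumr_ge0.
  by rewrite s1; lra.
move/eqP: p0; rewrite mulf_eq0 => /orP[]/eqP z0; [right|left]; apply: funext => v;
  rewrite /vertex_point.
  have [->|vy] := eqVneq v y; first by move: s1; rewrite z0 add0r.
  by have [->//|vx] := eqVneq v x; rewrite wz.
have [->|vx] := eqVneq v x; first by move: s1; rewrite z0 addr0.
by have [->//|vy] := eqVneq v y; rewrite wz.
Qed.

(** The gauge of the edge xy changes sign along any path from i P to i Q inside the
    image, pulled back by the inverse of i, so it vanishes somewhere; there the
    path passes through the image of x or of y, at distance at least delta from its
    starting point. *)
Lemma intrinsic_dist_leave_edge (R : realType) (n : nat) (V : finType) (e : rel V)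
    (i : {ptws V -> R} -> 'rV[R]_n) (x y : V) (P Q : {ptws V -> R}) (delta : R) :
  let X := realization (graph_complex e) in
  is_embedding X i -> x != y -> X P -> X Q ->
  0 < edge_gauge x y P -> edge_gauge x y Q < 0 ->
  delta <= `|i P - i (vertex_point R x)| -> delta <= `|i P - i (vertex_point R y)| ->
  (delta%:E <= intrinsic_dist (i @` X) (i P) (i Q))%E.
Proof.
move=> X [ci [g cg gK]] xy XP XQ GP GQ dx dy.
apply: le_ereal_inf_tmp => _ [c [cc cK c0 c1]] <-.
(* The gauge along the path, read in the realization. *)
have gc : {within `[0, 1], continuous (edge_gauge x y \o (g \o c))}.
  apply: (@continuous_within_comp _ _ _ _ setT) => //.
    by apply: continuous_within_comp cc cg _ => t; rewrite /= in_itv/=; exact: cK.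
  by apply: continuous_subspaceT; exact: edge_gauge_continuous.
have [] := @IVT R _ 0 1 0 ler01 gc.
  by rewrite /= c0 c1 !gK// ge_min le_max (ltW GQ) (ltW GP) orbT.
move=> t; rewrite in_itv/= => t01 Gt.
have [w Xw wE] := cK _ t01.
have gctE : g (c t) = w by rewrite -wE gK.
have t0 : 0 < t.
  rewrite lt_def (andP t01).1 andbT; apply: contraPneq Gt => ->.
  by rewrite c0 gK//; apply/eqP; rewrite gt_eqF.
have ht : 0 < t <= 1 by rewrite t0 (andP t01).2.
apply: le_trans (curve_length_ge c ht); rewrite lee_fin c0.
apply: le_trans (norm_le_edist _ _).
by rewrite gctE in Gt; rewrite -wE; have [->|->] := edge_gauge0 xy Xw Gt.
Qed.

(** * Choice of the scale *)

Definition vertices_within (R : realType) (n : nat) (V : finType)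
    (phi : V -> 'rV[R]_n) (v : V) (rho : R) : {set V} :=
  [set w | `|phi w - phi v| <= rho]%SET.

(** Among all balls whose centre and some boundary point are embedded vertices and
    which contain at least m vertices, take one of smallest radius r.  A cell of
    diameter less than r in the ball of radius 2r cannot contain m vertices, since
    a smaller ball around one of them would then contain m vertices; and
    truncn (2 (2r) / r) + 1 = 5 cells per coordinate suffice.  The assumption
    1 < m and injectivity are what makes r positive. *)
Lemma smallest_ball (R : realType) (n : nat) (V : finType)
    (phi : V -> 'rV[R]_n) (m : nat) :
  injective phi -> (1 < m)%N -> (m <= #|V|)%N ->
  exists v r, [/\ 0 < r, (m <= #|vertices_within phi v r|)%N &
    (#|vertices_within phi v (2 * r)| <= m.-1 * 5 ^ n)%N].
Proof.
move=> phi_inj m1 mV.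
pose P (a : V * V) := (m <= #|vertices_within phi a.1 `|phi a.2 - phi a.1|%R|)%N.
(* The ball around a reaching the farthest point of D contains D. *)
have big a (D : {set V}) : (m <= #|D|)%N -> exists2 u, u \in D & P (a, u).
  move=> mD; have /card_gt0P[u0 u0D] : (0 < #|D|)%N by lia.
  have [u uD umax] := @arg_maxP _ _ _ u0 (mem D) (fun u => `|phi u - phi a|) u0D.
  exists u => //; apply: leq_trans mD _.
  apply/subset_leq_card/fintype.subsetP => w wD.
  by rewrite inE; exact: umax.
have /card_gt0P[v0 _] : (0 < #|V|)%N by lia.
have [u0 _ Pu0] : exists2 u, u \in [set: V]%SET & P (v0, u).
  by apply: big; rewrite cardsT.
have [[v u] Pvu vumin] :=
  @arg_minP _ _ _ (v0, u0) P (fun a => `|phi a.2 - phi a.1|) Pu0.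
have r0 : 0 < `|phi u - phi v|.
  rewrite normr_gt0 subr_eq0; apply/eqP => /phi_inj uv.
  suff : (#|vertices_within phi v `|phi u - phi v|%R| <= 1)%N.
    by move: Pvu; rewrite /P/=; lia.
  rewrite -[X in (_ <= X)%N](cards1 v); apply/subset_leq_card/fintype.subsetP => w.
  by rewrite !inE uv subrr normr0 normr_le0 subr_eq0 => /eqP/phi_inj->.
exists v, `|phi u - phi v|; split => //.
have -> : 5%N = (Num.truncn (2 * (2 * `|phi u - phi v|) / `|phi u - phi v|)).+1.
  have -> : 2 * (2 * `|phi u - phi v|) / `|phi u - phi v| = 4%:R.
    by rewrite !mulrA mulfK ?gt_eqF// -natrM.
  by rewrite natrK.
apply: (@cube_cover _ _ _ _ phi (phi v)) => // [a|a _]; first by rewrite inE.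
rewrite -ltnS prednK; last by lia.
rewrite ltnNge; apply/negP => /(big a)[w]; rewrite inE => /andP[_] aw /vumin /=.
by rewrite leNgt distrC aw.
Qed.

(** * Choice of a radius that few vertices are close to *)

Definition level (R : realType) (r : R) (M : nat) (k : 'I_M) : R :=
  r + r * k%:R / M%:R.

Definition near_level (R : realType) (V : finType) (rho : V -> R) (r : R) (M : nat)
    (k : 'I_M) (v : V) : bool := `|rho v - level r k| < r / (2 * M%:R).

(** Consecutive levels are r/M apart. *)
Lemma near_level_unique (R : realType) (V : finType) (rho : V -> R) (r : R) (M : nat)
  (v : V) : 0 < r -> (#|[set k : 'I_M | near_level rho r k v]%SET| <= 1)%N.
Proof.
move=> r0; apply/card_le1_eqP => k l; rewrite !inE /near_level => hk hl.
have M0 : 0 < M%:R :> R by rewrite ltr0n; exact: leq_ltn_trans (ltn_ord k).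
have E (j : 'I_M) : level r j = r + r / M%:R * j%:R by rewrite /level mulrAC.
have E2 : r / (2 * M%:R) = r / M%:R / 2 by rewrite invfM mulrA mulrAC.
have c0 : 0 < r / M%:R by rewrite divr_gt0.
have {hk hl} : `|k%:R - l%:R| < 1 :> R.
  rewrite -(ltr_pM2l c0) mulr1 -[X in X * _](gtr0_norm c0) -normrM mulrBr.
  move: hk hl; rewrite !E !E2 !ltr_norml; lra.
rewrite ltr_norml => /andP[h1 h2]; apply/val_inj/eqP.
rewrite eqn_leq -(ltnS k) -(ltnS l) -!(ltr_nat R) -!natr1.
by apply/andP; split; lra.
Qed.

(** By [near_level_unique] each edge is counted for at most two of the M levels,
    one per endpoint. *)
Lemma pigeonhole_level (R : realType) (V : finType) (rho : V -> R) (r : R) (M : nat)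
    (E : {set V * V}) : 0 < r -> (0 < M)%N ->
  exists k : 'I_M, (M * #|[set a in E |
     near_level rho r k a.1 || near_level rho r k a.2]%SET| <= 2 * #|E|)%N.
Proof.
move=> r0 M0; apply/existsP/contraT; rewrite negb_exists => /forallP big.
pose bad (k : 'I_M) a := near_level rho r k a.1 || near_level rho r k a.2.
have : (\sum_(k < M) #|[set a in E | bad k a]%SET| <= 2 * #|E|)%N.
  under eq_bigr do rewrite -sum1dep_card big_mkcondr.
  rewrite exchange_big/= mulnC -sum_nat_const leq_sum// => a _.
  rewrite -big_mkcond sum1dep_card.
  apply: (@leq_trans #|[set k | near_level rho r k a.1] :|:
                      [set k | near_level rho r k a.2]|%SET).
    by apply/subset_leq_card/fintype.subsetP => k; rewrite !inE.
  apply: leq_trans (leq_card_setU _ _) _.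
  exact: leq_add (near_level_unique rho M a.1 r0) (near_level_unique rho M a.2 r0).
rewrite -(leq_pmul2l M0) leqNgt big_distrr/= => /negP[].
apply: (@leq_trans (\sum_(k < M) (2 * #|E|).+1)%N).
  by rewrite sum_nat_const card_ord ltn_pmul2l.
by apply: leq_sum => k _; have := big k; rewrite -ltnNge.
Qed.

Lemma card_edges_le (V : finType) (e : rel V) (d : nat) :
  (forall v, (degree e v <= d)%N) ->
  (#|[set a : V * V | e a.1 a.2]%SET| <= d * #|V|)%N.
Proof.
move=> hd; rewrite -sum1dep_card mulnC -sum_nat_const.
rewrite -(pair_big_dep xpredT (fun x y => e x y) (fun _ _ => 1%N))/=.
by apply: leq_sum => v _; rewrite sum1dep_card; exact: hd.
Qed.

(** * Separation of the points where edges cross a cube boundary *)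

Lemma embedding_inj (T U : topologicalType) (X : set T) (i : T -> U) (x y : T) :
  is_embedding X i -> X x -> X y -> i x = i y -> x = y.
Proof. by move=> [_ [g _ gK]] Xx Xy ixy; rewrite -(gK x)// ixy gK. Qed.

(** The intermediate value theorem for the distance to p along the embedded edge. *)
Lemma crossing_point (R : realType) (n : nat) (V : finType) (e : rel V)
    (i : {ptws V -> R} -> 'rV[R]_n) (x y : V) (p : 'rV[R]_n) (rho : R) :
  is_embedding (realization (graph_complex e)) i -> e x y -> x != y ->
  `|i (vertex_point R x) - p| < rho -> rho < `|i (vertex_point R y) - p| ->
  exists2 t : R, 0 < t < 1 & `|i (edge_point x y t) - p| = rho.
Proof.
move=> [ci _] exy xy hx hy.
pose f t := `|i (edge_point x y t) - p|.
have fc : {within `[0, 1], continuous f}.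
  rewrite -[f]/((fun z => `|z - p|) \o (i \o edge_point x y)).
  apply: (@continuous_within_comp _ _ _ _ setT) => //.
    apply: (continuous_within_comp _ ci).
      by apply: continuous_subspaceT; exact: edge_point_continuous.
    by move=> t; rewrite /= in_itv/=; exact: edge_point_realization.
  apply: continuous_subspaceT => z.
  have F := nbhs_filter z.
  have h1 : id u @[u --> nbhs z] --> (z : 'rV[R]_n) by exact: cvg_id.
  have h2 : cst p u @[u --> nbhs z] --> (p : 'rV[R]_n) by exact: cvg_cst.
  exact: cvg_norm (cvgB h1 h2).
have f0 : f 0 < rho by rewrite /f edge_point0.
have f1 : rho < f 1 by rewrite /f edge_point1.
have [] := @IVT R f 0 1 rho ler01 fc.
  by rewrite ge_min le_max (ltW f0) (ltW f1) orbT.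
move=> t; rewrite in_itv/= => /andP[t0 t1] ft; exists t => //.
rewrite !lt_def t0 t1 !andbT; apply/andP; split; apply/eqP => tE.
  by move: f0; rewrite -tE ft ltxx.
by move: f1; rewrite tE ft ltxx.
Qed.

Lemma edge_gauge_inside (R : realType) (V : finType) (x y : V) (t : R) :
  x != y -> 0 < t < 1 -> 0 < edge_gauge x y (edge_point x y t).
Proof.
move=> xy /andP[t0 t1]; rewrite /edge_gauge /edge_point !eqxx (negPf xy).
rewrite eq_sym (negPf xy) !mulr0 !mulr1 addr0 add0r.
have := mulr_gt0 (_ : 0 < 1 - t) t0; rewrite subr_gt0 => /(_ t1); lra.
Qed.

Lemma edge_gauge_outside (R : realType) (V : finType) (x y a b : V) (t : R) :
  a != y -> x != b -> (x, y) != (a, b) -> 0 < t < 1 ->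
  edge_gauge x y (edge_point a b t) < 0.
Proof.
move=> ay xb; rewrite xpair_eqE => xyab /andP[t0 t1].
rewrite /edge_gauge /edge_point (eq_sym y a) (negPf ay) (negPf xb).
by move: xyab; case: eqVneq => _; case: eqVneq => _ //= _; lra.
Qed.

(** Each edge of A joins a vertex well inside the cube of centre p and radius rho to
    one well outside, so it has a point on the cube boundary at distance at least
    eps from its endpoints.  Two distinct edges of A may share an endpoint but, being
    oriented outwards, are not the same unoriented edge.  Hence these points are at
    intrinsic distance at least eps, and at sup distance at least
    eps / (B (n+1)). *)
Lemma separated_crossings (R : realType) (n : nat) (V : finType) (e : rel V)
    (i : {ptws V -> R} -> 'rV[R]_n.+1) (B : R) (A : {set V * V})
    (p : 'rV[R]_n.+1) (rho eps : R) :
  irreflexive e -> is_embedding (realization (graph_complex e)) i ->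
  0 < B -> (distortion (i @` realization (graph_complex e)) <= B%:E)%E ->
  0 < rho -> 0 < eps ->
  (forall a, a \in A -> [/\ e a.1 a.2, `|i (vertex_point R a.1) - p| <= rho - eps &
     rho + eps <= `|i (vertex_point R a.2) - p|]) ->
  (#|A| <= 2 * n.+1 * (Num.truncn (2 * rho / (eps / (B * n.+1%:R)))).+1 ^ n)%N.
Proof.
move=> eirr ei B0 dB rho0 eps0 hA.
have ene x y : e x y -> x != y.
  by move=> exy; apply/eqP => xy; rewrite xy eirr in exy.
have ex a : exists t : R,
    a \in A -> 0 < t < 1 /\ `|i (edge_point a.1 a.2 t) - p| = rho.
  have [aA|] := boolP (a \in A); last by exists 0.
  have [ea h1 h2] := hA _ aA.
  have [||t t01 tE] := crossing_point (p := p) (rho := rho) ei ea (ene _ _ ea).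
  - lra.
  - lra.
  by exists t.
have [t tP] := choice ex.
pose P a := edge_point a.1 a.2 (t a); pose z a := i (P a).
have XP a : a \in A -> realization (graph_complex e) (P a).
  move=> aA; have [ea _ _] := hA _ aA; have [/andP[t0 t1] _] := tP _ aA.
  by apply: edge_point_realization => //; rewrite ?ene// !ltW.
have n0 : 0 < n.+1%:R :> R by rewrite ltr0n.
apply: (@cube_boundary_packing _ _ _ A z p) => //.
- by rewrite divr_gt0// mulr_gt0.
- by move=> a /tP[].
move=> a b aA bA ab.
have [ea a1 a2] := hA _ aA; have [eb b1 b2] := hA _ bA.
have [ta za] := tP _ aA; have [tb zb] := tP _ bA.
have Ga : 0 < edge_gauge a.1 a.2 (P a) by apply: edge_gauge_inside => //; exact: ene.
have Gb : edge_gauge a.1 a.2 (P b) < 0.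
  have ab' : (a.1, a.2) != (b.1, b.2) by case: (a) (b) ab => ? ? [].
  apply: (edge_gauge_outside _ _ ab' tb); apply/eqP => E.
    by rewrite E in b1; lra.
  by rewrite E in a1; lra.
have zab : z a != z b.
  apply/eqP => /(embedding_inj ei (XP _ aA) (XP _ bA)) E.
  by rewrite E in Ga; lra.
have far v : eps <= `| `|i (vertex_point R v) - p| - rho| ->
    eps <= `|z a - i (vertex_point R v)|.
  move=> /le_trans; apply; rewrite -za (le_trans (ler_dist_dist _ _))//.
  by rewrite opprB addrA subrK distrC.
have : (eps%:E <= intrinsic_dist (i @` realization (graph_complex e)) (z a) (z b))%E.
  apply: (intrinsic_dist_leave_edge ei (ene _ _ ea) (XP _ aA) (XP _ bA) Ga Gb).
    by apply: far; rewrite ler0_norm; lra.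
  by apply: far; rewrite ger0_norm; lra.
move/(distortion_edist_ge dB _ _ zab) => h.
have {}h : eps <= B * edist (z a) (z b).
  by apply: h; [exists (P a) | exists (P b)] => //; exact: XP.
rewrite ler_pdivrMr ?mulr_gt0// mulrC -mulrA; apply: le_trans h _.
by rewrite ler_pM2l// edist_le_norm.
Qed.

(** A path is at least as long as the distance between its endpoints. *)
Lemma distortion_ge1 (R : realType) (n : nat) (K : set 'rV[R]_n) (B : R)
    (x y : 'rV[R]_n) :
  K x -> K y -> x != y -> (distortion K <= B%:E)%E -> 1 <= B.
Proof.
move=> Kx Ky xy /distortion_edist_ge/(_ Kx Ky xy (intrinsic_dist_ge_edist _ _ _)).
have e0 : 0 < edist x y.
  by apply: lt_le_trans (norm_le_edist x y); rewrite normr_gt0 subr_eq0.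
by rewrite -[X in X <= _]mul1r ler_pM2r.
Qed.

(** * Expanders *)

(** The expansion hypothesis gives alpha m boundary edges at every level.  The lower
    bound on M makes the number of edges with an endpoint near the level provided
    by [pigeonhole_level], at most 2 d |V| / M, no more than half of alpha m. *)
Lemma clear_crossing_edges (R : realType) (n : nat) (alpha : R) (d m q M : nat)
    (V : finType) (e : rel V) (phi : V -> 'rV[R]_n) (v : V) (r : R) :
  is_expander alpha e -> (forall v, (degree e v <= d)%N) -> 0 < alpha ->
  0 < r -> (0 < M)%N -> (#|V| <= m * q)%N ->
  (4 * d * q)%:R <= alpha * M%:R ->
  (m <= #|vertices_within phi v r|)%N ->
  (2 * #|vertices_within phi v (2 * r)| <= #|V|)%N ->
  exists rho (A : {set V * V}), [/\ r <= rho <= 2 * r,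
    (forall a, a \in A -> [/\ e a.1 a.2,
      `|phi a.1 - phi v| <= rho - r / (2 * M%:R) &
      rho + r / (2 * M%:R) <= `|phi a.2 - phi v|]) &
    alpha * m%:R <= 2 * #|A|%:R].
Proof.
move=> he hd a0 r0 M0 Nmq Mbig mball ball2.
pose E := [set a : V * V | e a.1 a.2]%SET.
pose dist w := `|phi w - phi v|.
have [k hk] := pigeonhole_level dist E r0 M0.
set bad := [set a in E | _]%SET in hk.
have M0R : 0 < M%:R :> R by rewrite ltr0n.
have rhoB : r <= level r k <= 2 * r.
  rewrite /level lerDl divr_ge0 ?mulr_ge0 ?(ltW r0)//= mulr2n mulrDl !mul1r lerD2l.
  by rewrite ler_pdivrMr// ler_pM2l// ler_nat ltnW.
set rho := level r k in rhoB *.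
pose S := vertices_within phi v rho.
have mS : (m <= #|S|)%N.
  apply: leq_trans mball _; apply/subset_leq_card/fintype.subsetP => w.
  by rewrite !inE => /le_trans; apply; case/andP: rhoB.
have S2 : #|S|%:R <= #|V|%:R / 2 :> R.
  rewrite ler_pdivlMr// -natrM ler_nat mulnC; apply: leq_trans ball2.
  rewrite leq_mul2l/=; apply/subset_leq_card/fintype.subsetP => w.
  by rewrite !inE => /le_trans; apply; case/andP: rhoB.
exists rho, (edge_boundary e S :\: bad)%SET; split => //.
  move=> a; rewrite !inE => /andP[+ /and3P[aS aS' ea]].
  rewrite ea /= negb_or /near_level -!leNgt -ltNge in aS' * => /andP[].
  move: aS aS'; rewrite -/rho -/(dist a.1) -/(dist a.2).
  set eps := r / _ => h1 h2.
  by rewrite ler0_norm ?subr_le0// gtr0_norm ?subr_gt0// => h3 h4; split => //; lra.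
have hS := he S S2.
have hAB :
    #|edge_boundary e S|%:R <= #|edge_boundary e S :\: bad|%SET%:R + #|bad|%:R :> R.
  rewrite -natrD ler_nat -(cardsID bad (edge_boundary e S)) addnC leq_add2l.
  by rewrite subset_leq_card// subsetIr.
have hbad : 2 * #|bad|%:R <= alpha * m%:R.
  rewrite -(ler_pM2l M0R).
  have h1 : (M * (2 * #|bad|) <= 4 * d * q * m)%N.
    have hE : (#|E| <= d * (m * q))%N.
      by apply: leq_trans (card_edges_le hd) _; rewrite leq_mul2l Nmq orbT.
    have -> : (4 * d * q * m = 2 * (2 * (d * (m * q))))%N by lia.
    by rewrite mulnCA leq_mul2l /= (leq_trans hk)// leq_mul2l.
  move: h1; rewrite -(ler_nat R) !natrM => h1; apply: le_trans h1 _.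
  by rewrite mulrA ler_wpM2r// (mulrC M%:R) -!natrM.
have hmS : alpha * m%:R <= alpha * #|S|%:R by rewrite ler_pM2l// ler_nat.
lra.
Qed.

(** Graphs with fewer than q = 2 * 5^(n+1) vertices are covered by B >= 1, and the
    term q of the constant; for the others, m = floor (|V| / q) + 1 is at least 2, as
    [smallest_ball] requires, while (m - 1) 5^(n+1) <= |V| / 2. *)
Lemma expander_card_le (R : realType) (n : nat) (alpha : R) (d : nat) : 0 < alpha ->
  exists2 K1 : R, 1 <= K1 & forall (V : finType) (e : rel V)
      (i : {ptws V -> R} -> 'rV[R]_n.+1) (B : R),
    irreflexive e -> (2 <= #|V|)%N -> is_expander alpha e ->
    (forall v, (degree e v <= d)%N) ->
    is_embedding (realization (graph_complex e)) i ->
    (distortion (i @` realization (graph_complex e)) <= B%:E)%E ->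
    #|V|%:R <= K1 * B ^+ n.
Proof.
move=> a0; pose q := (2 * 5 ^ n.+1)%N.
pose M := (Num.truncn ((4 * d * q)%:R / alpha)).+1.
have q0 : (1 < q)%N by rewrite /q; have := expn_gt0 5 n.+1; lia.
have Mbig : (4 * d * q)%:R <= alpha * M%:R.
  by rewrite mulrC -ler_pdivrMr// ltW// truncnS_gt.
have M0 : 0 < M%:R :> R by rewrite ltr0n.
pose L : R := (9 * M * n.+1)%:R.
pose K2 : R := q%:R * (4 * n.+1%:R / alpha) * L ^+ n.
have K20 : 0 <= K2.
  by rewrite mulr_ge0 ?exprn_ge0// mulr_ge0// divr_ge0 ?(ltW a0).
exists (q%:R + K2).
  by apply: (@le_trans _ _ q%:R); [rewrite ler1n ltnW | rewrite lerDl].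
move=> V e i B eirr V2 he hd ei dB.
pose phi v := i (vertex_point R v).
have phi_inj : injective phi.
  move=> x y h; apply: (@vertex_point_inj R); apply: embedding_inj ei _ _ h;
    exact: vertex_point_realization.
have B1 : 1 <= B.
  have /card_gt1P[x [y [_ _ xy]]] := V2.
  apply: (@distortion_ge1 _ _ _ _ (phi x) (phi y) _ _ _ dB).
  - by exists (vertex_point R x) => //; exact: vertex_point_realization.
  - by exists (vertex_point R y) => //; exact: vertex_point_realization.
  - by apply: contra_neq xy => /phi_inj.
have B0 : 0 < B by apply: lt_le_trans B1.
have Bn1 : 1 <= B ^+ n by rewrite exprn_ege1.
rewrite mulrDl.
have [Nq|qN] := ltnP #|V| q.
  apply: (@le_trans _ _ q%:R); first by rewrite ler_nat ltnW.
  apply: (@le_trans _ _ (q%:R * B ^+ n)); first exact: ler_peMr.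
  by rewrite lerDl mulr_ge0// exprn_ge0// ltW.
pose m := (#|V| %/ q).+1.
have Nmq : (#|V| <= m * q)%N by rewrite ltnW// ltn_ceil// ltnW.
have m1 : (1 < m)%N by rewrite ltnS divn_gt0// ltnW.
have mV : (m <= #|V|)%N by rewrite ltn_Pdiv// ltnW.
have [v [r [r0 mball ball2]]] := smallest_ball phi_inj m1 mV.
have ball2' : (2 * #|vertices_within phi v (2 * r)| <= #|V|)%N.
  apply: (@leq_trans (2 * ((#|V| %/ q) * 5 ^ n.+1))%N).
    by rewrite leq_mul2l ball2.
  by rewrite mulnCA -/q leq_divM.
have [rho [A [/andP[r1 r2] hA Abig]]] :=
  clear_crossing_edges he hd a0 r0 (ltn0Sn _) Nmq Mbig mball ball2'.
have rho0 : 0 < rho by apply: lt_le_trans r1.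
have eps0 : 0 < r / (2 * M%:R) by rewrite divr_gt0// mulr_gt0.
have cA := separated_crossings eirr ei B0 dB rho0 eps0 hA.
have n0 : 0 < n.+1%:R :> R by rewrite ltr0n.
set t := Num.truncn _ in cA.
have tL : t.+1%:R <= L * B.
  have x0 : 0 <= 2 * rho / (r / (2 * M%:R) / (B * n.+1%:R)).
    by rewrite !(divr_ge0, mulr_ge0)// ltW.
  (* The exact value for the largest radius rho = 2 r; the constant 9 in L leaves
     room for the successor. *)
  have : t%:R <= 8 * M%:R * n.+1%:R * B.
    apply: (@le_trans _ _ (2 * rho / (r / (2 * M%:R) / (B * n.+1%:R)))).
      by rewrite truncn_le.
    rewrite ler_pdivrMr ?divr_gt0 ?mulr_gt0//.
    apply: (@le_trans _ _ (2 * (2 * r))); first by rewrite ler_pM2l.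
    rewrite le_eqVlt; apply/orP; left; apply/eqP.
    by field; rewrite !gt_eqF.
  have : 1 <= M%:R * n.+1%:R * B :> R.
    by rewrite mulr_ege1// -natrM ler1n muln_gt0.
  by rewrite -natr1 /L !natrM; lra.
have tLn : t.+1%:R ^+ n <= (L * B) ^+ n by rewrite lerXn2r// nnegrE ?mulr_ge0// ltW.
have cA' : #|A|%:R <= 2 * n.+1%:R * (L * B) ^+ n :> R.
  move: cA; rewrite -(ler_nat R) !natrM natrX => /le_trans; apply.
  by rewrite ler_pM2l// mulr_gt0.
apply: (@le_trans _ _ (K2 * B ^+ n)); last first.
  by rewrite lerDr mulr_ge0// exprn_ge0// ltW.
apply: (@le_trans _ _ (q%:R * m%:R)); first by rewrite -natrM ler_nat mulnC.
rewrite /K2 -!mulrA ler_pM2l ?ltr0n ?(ltnW q0)//.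
rewrite -exprMn !mulrA -(ler_pM2l a0).
apply: le_trans Abig _.
rewrite (_ : alpha * _ = 2 * (2 * n.+1%:R * (L * B) ^+ n)).
  by rewrite ler_pM2l.
by field; rewrite gt_eqF.
Qed.

Theorem mainTheorem6 (R : realType) (n : nat) (n_ge3 : (3 <= n)%N)
    (alpha : R) (alpha_gt0 : 0 < alpha) (d : nat) :
  exists2 C : R, 0 < C &
    forall (V : finType) (e : rel V),
      symmetric e -> irreflexive e -> (2 <= #|V|)%N ->
      is_expander alpha e -> (forall v : V, (degree e v <= d)%N) ->
      ((C * #|V|%:R `^ (n.-1)%:R^-1)%:E < intrinsic_distortion R n (graph_complex e))%E.
Proof.
case: n n_ge3 => // n n2; rewrite [n.+1.-1]/=.
have [K K1 hK] := expander_card_le n d alpha_gt0.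
have K0 : 0 < K by apply: lt_le_trans K1.
(* With B = 2 C |V|^(1/n) and 2 C = 1 / (2 K) <= 1, the bound K B^n on |V| is at most
   |V| / 2.  The factor 2 makes the final inequality strict. *)
exists (4 * K)^-1; first by rewrite invr_gt0 mulr_gt0.
move=> V e _ eirr V2 he hd.
set C := (4 * K)^-1; set x := _ `^ _.
have N0 : 0 < #|V|%:R :> R by rewrite ltr0n ltnW.
have C0 : 0 < C by rewrite invr_gt0 mulr_gt0.
have x0 : 0 < x by rewrite powR_gt0.
have n0 : (0 < n)%N by rewrite ltnW.
have xn : x ^+ n = #|V|%:R.
  by rewrite -powR_mulrn ?powR_ge0// -powRrM mulVf ?powRr1 ?ltW// pnatr_eq0 -lt0n.
have lt1 : ((C * x)%:E < (2 * C * x)%:E)%E.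
  by rewrite lte_fin ltr_pM2r// ltr_pMl// ltr1n.
apply: lt_le_trans lt1 _; apply: le_ereal_inf_tmp => _ [i ei <-].
rewrite leNgt; apply/negP => /ltW dB.
have := hK _ _ _ _ eirr V2 he hd ei dB.
rewrite leNgt => /negP; apply.
rewrite exprMn xn mulrA -[ltRHS]mul1r ltr_pM2r//.
have E : 2 * C * K = 2^-1 by rewrite /C; field; rewrite gt_eqF.
have C1 : 2 * C <= 1.
  rewrite -(ler_pM2r K0) E mul1r; apply: le_trans K1; lra.
have Cn : (2 * C) ^+ n <= 2 * C.
  by rewrite -[leRHS]expr1 ler_wiXn2l// mulr_ge0// ltW.
rewrite mulrC; apply: (@le_lt_trans _ _ (2 * C * K)); first by rewrite ler_pM2r.
by rewrite E; lra.
Qed.
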